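(* Let $r$ be an integer with $0\le r\le\underline{\kappa}_0+1$ and let $\varphi^{r,\ast}\in\mathbb{P}^{\underline{\kappa}_0+1}_{\max}[\Omega]$, with $\|\varphi^{r,\ast}\|_{H^{p+1}(\Omega)}=1$, be a function at which the supremum $$\sup_{0\neq\varphi\in\mathbb{P}^{\underline{\kappa}_0+1}_{\max}[\Omega]}\ \inf_{\varphi_h\in\mathcal{S}[p;\mathcal{M}^0_\ast]}\frac{|\varphi-\varphi_h|_{\mathcal{H}^r(\Omega;\mathcal{M}^0_\ast)}}{\|\varphi\|_{H^{p+1}(\Omega)}}$$ is attained. Let $$\underline{C}_0=\inf_{\varphi_h\in\mathcal{S}[p;\mathcal{M}^0]}\|\varphi^{r,\ast}-\varphi_h\|_{L^\infty(\Omega^0)}>0 .$$ Then there exists a constant $\underline{c}_0>0$, independent of $\ell$, such that for all integers $\ell\ge0$ $$\inf_{\varphi_h\in\mathcal{S}[p;\mathcal{M}^\ell]}\|\varphi^{r,\ast}-\varphi_h\|_{L^\infty(\Omega\setminus\overline{\omega^{\ell+1}_\ast})}\ \ge\ \max\left(\underline{C}_0\,\lambda^{\ell(\underline{\kappa}_0+1)},\ \underline{c}_0\,\frac{1}{2^{\ell(p+1)}}\right).$$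
   Context: Domain. $\Omega\subset\mathbb{R}^2$ is an open domain containing the origin with $\overline{\Omega}=\bigcup_{i=0}^\infty\overline{\Omega^i}$, where the $\Omega^i$ are open, pairwise disjoint, ring-shaped subdomains around the origin. Each ring $\Omega^i$ is composed of $N$ (pairwise disjoint, open) elements $\omega^i_1,\dots,\omega^i_N$, i.e. $\overline{\Omega^i}=\bigcup_n\overline{\omega^i_n}$, with $C^\infty$-smooth, regular parameterizations $\mathbf{G}^i_n:B\to\omega^i_n$, $B=\,]0,1[^2$ (regular: bijective onto $\omega^i_n$, smooth and with nonvanishing Jacobian determinant up to the boundary of $B$). There is a fixed $\lambda\in\,]0,1[$ with $\mathbf{G}^i_n=\lambda^i\,\mathbf{G}^0_n$ for all $i,n$; consequently $\Omega^{i+1}=\lambda\Omega^i$. All $\mathbf{G}^i_n$ are polynomial mappings, $\mathbf{G}^i_n\in(\mathbb{Q}^q)^2$ for some degree $q$. Here $\mathbb{Q}^k$ denotes polynomials of degree at most $k$ in each variable and $\mathbb{P}^k$ polynomials of total degree at most $k$ (with $[D]$ denoting the domain $D$). Meshes. For an integer $k\ge0$, $\widehat{\mathcal{M}}^k$ is the set of the $4^k$ open squares $]j_1/2^k,(j_1+1)/2^k[\times]j_2/2^k,(j_2+1)/2^k[$, $0\le j_1,j_2\le 2^k-1$. For $0\le i\le\ell$: $\mathcal{M}^\ell_{i,n}=\{\mathbf{G}^i_n(b):b\in\widehat{\mathcal{M}}^{\ell-i}\}$, $\mathcal{M}^\ell_i=\bigcup_{n=1}^N\mathcal{M}^\ell_{i,n}$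 (a mesh on $\Omega^i$), $\mathcal{M}^\ell=\bigcup_{i=0}^\ell\mathcal{M}^\ell_i$. The cap is the single element $\omega^{\ell+1}_\ast=\mathrm{int}\big(\bigcup_{i\ge\ell+1}\overline{\Omega^i}\big)=\lambda^{\ell+1}\Omega$, and $\mathcal{M}^\ell_\ast=\mathcal{M}^\ell\cup\{\omega^{\ell+1}_\ast\}$. Thus $\mathcal{M}^\ell$ covers $\Omega\setminus\overline{\omega^{\ell+1}_\ast}$ up to a null set, and $\mathcal{M}^0$ is the mesh $\{\omega^0_1,\dots,\omega^0_N\}$ of $\Omega^0$. Discrete spaces. $p$ is a fixed degree. For $\omega\in\mathcal{M}^\ell_{i,n}$, $\mathcal{S}[p;\omega]=\{\varphi:\omega\to\mathbb{R}:\varphi\circ\mathbf{G}^i_n\in\mathbb{Q}^p\}$ (composition on the sub-square $b$ with $\omega=\mathbf{G}^i_n(b)$). On the cap, $\mathcal{S}[p;\omega^{\ell+1}_\ast]$ is a suitable finite-dimensional function space (contained in $H^r(\omega^{\ell+1}_\ast)$). For a subset $\Theta\subseteq\mathcal{M}^\ell_\ast$ covering $\theta$ (i.e. $\overline\theta=\bigcup_{\omega\in\Theta}\overline\omega$), $\mathcal{S}[p;\Theta]=\{\varphi\in L^2(\theta):\varphi|_\omega\in\mathcal{S}[p;\omega]\ \forall\omega\in\Theta\}$ (no interelement continuity). Norms. $|\cdot|_{H^r(\omega)}$ is the standard Sobolev seminorm, $|\varphi|^2_{H^r(\omega)}=\int_\omega\sum_{\alpha_x+\alpha_y=r}(\partial_x^{\alpha_x}\partial_y^{\alpha_y}\varphi)^2$,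 and the broken seminorm is $|\varphi|^2_{\mathcal{H}^r(\theta;\Theta)}=\sum_{\omega\in\Theta}|\varphi|^2_{H^r(\omega)}$. Reproduction degree. $\kappa[\omega]$ is the largest integer with $\mathbb{P}^{\kappa[\omega]}[\omega]\subseteq\mathcal{S}[p;\omega]$. Set $\underline{\kappa}_0=\min_{\omega\in\mathcal{M}^0}\kappa[\omega]$ (the cap is not included in $\mathcal{M}^0$), and assume $\kappa[\omega^1_\ast]\ge\underline{\kappa}_0$. Finally $\mathbb{P}^{\underline{\kappa}_0+1}_{\max}[\Omega]=\mathrm{span}\{x^{\underline{\kappa}_0+1},x^{\underline{\kappa}_0}y,\dots,y^{\underline{\kappa}_0+1}\}$. *)

(* Defs.v *)
(* MathComp-Analysis, over an arbitrary R : realType. *)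
From mathcomp Require Import all_boot all_order all_algebra.
From mathcomp Require Import all_classical all_reals all_analysis.

Set Implicit Arguments.
Unset Strict Implicit.
Unset Printing Implicit Defensive.

Import Order.TTheory GRing.Theory Num.Theory.
Import numFieldNormedType.Exports.

Local Open Scope classical_set_scope.
Local Open Scope ring_scope.

(* measurableTypeR R is R with its Borel sigma-algebra. The product carries the
   sup norm, hence the Euclidean topology. *)
Definition plane (R : realType) := (measurableTypeR R * measurableTypeR R)%type.

Definition leb2 (R : realType) : {measure set (plane R) -> \bar R} :=
  (@lebesgue_measure R \x @lebesgue_measure R)%E.

Section polynomials.
Context {R : realType}.
Implicit Type f : plane R -> R.

(* Degree at most k in each variable. *)
Definition poly_Q (k : nat) : set (plane R -> R) :=
  [set f | exists c : 'I_k.+1 -> 'I_k.+1 -> R, forall z,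
     f z = \sum_(a < k.+1) \sum_(b < k.+1) c a b * z.1 ^+ a * z.2 ^+ b].

(* Total degree at most k. *)
Definition poly_P (k : nat) : set (plane R -> R) :=
  [set f | exists c : 'I_k.+1 -> 'I_k.+1 -> R, forall z,
     f z = \sum_(a < k.+1) \sum_(b < k.+1 | (a + b <= k)%N) c a b * z.1 ^+ a * z.2 ^+ b].

(* The span of x^k, x^(k-1) y, ..., y^k. *)
Definition poly_Pmax (k : nat) : set (plane R -> R) :=
  [set f | exists c : 'I_k.+1 -> R, forall z,
     f z = \sum_(b < k.+1) c b * z.1 ^+ (k - b) * z.2 ^+ b].

End polynomials.

Section calculus.
Context {R : realType}.
Implicit Types (f g psi : plane R -> R) (U : set (plane R)).

Definition pdx f : plane R -> R := 'D_((1, 0) : plane R) f.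
Definition pdy f : plane R -> R := 'D_((0, 1) : plane R) f.
Definition partial (a b : nat) f : plane R -> R := iter a pdx (iter b pdy f).

Definition jacobian_det (F : plane R -> plane R) (z : plane R) : R :=
  pdx (fst \o F) z * pdy (snd \o F) z - pdy (fst \o F) z * pdx (snd \o F) z.

(* C^oo on the plane; derivatives taken in another order exist and agree with
   these by Schwarz's theorem. *)
Definition smooth f := forall (a b : nat) (z : plane R),
  differentiable (partial a b f) z.

Definition test_function U psi :=
  [/\ smooth psi, compact (closure [set z | psi z != 0]) &
      closure [set z | psi z != 0] `<=` U].

Definition loc_integrable U f := measurable_fun U f /\
  forall K, compact K -> K `<=` U -> (leb2 R).-integrable K (EFin \o f).

Definition weak_partial U (a b : nat) f g :=
  [/\ loc_integrable U f, loc_integrable U g &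
    forall psi, test_function U psi ->
      (\int[leb2 R]_(z in U) (f z * partial a b psi z) =
       (-1) ^+ (a + b) * \int[leb2 R]_(z in U) (g z * psi z))].

(* The square of |f|_{H^k(U)}. Weak derivatives are unique almost everywhere,
   so the infimum is over at most one value; it is over the empty set, hence
   +oo, when some weak derivative of order k does not exist. *)
Definition sobolev_semi_sq (k : nat) U f : \bar R :=
  ereal_inf [set \int[leb2 R]_(z in U) (\sum_(a < k.+1) g a z ^+ 2)%:E
    | g in [set g : 'I_k.+1 -> plane R -> R |
             forall a : 'I_k.+1, weak_partial U a (k - a) f (g a)]]%E.

Definition sobolev_norm (k : nat) U f : \bar R :=
  sqrte (\sum_(j < k.+1) sobolev_semi_sq j U f)%E.

Definition sobolev_space (k : nat) U : set (plane R -> R) :=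
  [set f | (sobolev_norm k U f < +oo)%E].

Definition L2 U : set (plane R -> R) :=
  [set f | measurable_fun U f /\ ('N[leb2 R]_2%:E[EFin \o (f \_ U)] < +oo)%E].

Definition Linf_norm U f : \bar R := ('N[leb2 R]_+oo[EFin \o (f \_ U)])%E.

End calculus.

Section geometry.
Variable R : realType.

Definition unit_square : set (plane R) :=
  [set z | 0 < z.1 < 1 /\ 0 < z.2 < 1].

Definition scale_set (t : R) (A : set (plane R)) : set (plane R) :=
  [set t *: z | z in A].

(* A connected set separating the origin from infinity. *)
Definition ring_shaped (A : set (plane R)) :=
  [/\ connected A, ~ closure A 0 & bounded_set (connected_component (~` A) 0)].

Record ring_domain := RingDomain {
  Omega : set (plane R) ;
  annulus : nat -> set (plane R) ;
  nelt : nat ;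
  lambda : R ;
  gdeg : nat ;
  G : nat -> 'I_nelt -> plane R -> plane R ;
  Omega_open : open Omega ;
  Omega_connected : connected Omega ;
  Omega_origin : Omega 0 ;
  (* The outer closure only adds the origin, towards which the annuli shrink
     and which belongs to the closure of none of them. *)
  Omega_closure : closure Omega = closure (\bigcup_i closure (annulus i)) ;
  annulus_open : forall i, open (annulus i) ;
  annulus_ring : forall i, ring_shaped (annulus i) ;
  annulus_sub : forall i, annulus i `<=` Omega ;
  annulus_disj : trivIset setT annulus ;
  lambda_gt0 : 0 < lambda ;
  lambda_lt1 : lambda < 1 ;
  G_poly : forall i n,
    poly_Q gdeg (fst \o G i n) /\ poly_Q gdeg (snd \o G i n) ;
  G_inj : forall i n, set_inj unit_square (G i n) ;
  G_regular : forall i n z,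
    closure unit_square z -> jacobian_det (G i n) z != 0 ;
  G_scale : forall i n z, G i n z = lambda ^+ i *: G 0 n z ;
  elt_open : forall i n, open (G i n @` unit_square) ;
  elt_sub : forall i n, G i n @` unit_square `<=` annulus i ;
  elt_disj : forall i, trivIset setT (fun n => G i n @` unit_square) ;
  annulus_closure : forall i,
    closure (annulus i) = \bigcup_n closure (G i n @` unit_square) ;
  annulus_scale : forall i, annulus i.+1 = scale_set lambda (annulus i)
}.

End geometry.

Section discretization.
Context {R : realType}.
Variables (D : ring_domain R) (p : nat).

(* An element omega together with its local space S[p; omega]; membership in
   the local space only depends on the values taken on omega. *)
Definition element := (set (plane R) * set (plane R -> R))%type.

Definition subsquare (k : nat) (j : 'I_(2 ^ k) * 'I_(2 ^ k)) : set (plane R) :=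
  [set z | j.1%:R / 2 ^+ k < z.1 < j.1.+1%:R / 2 ^+ k /\
           j.2%:R / 2 ^+ k < z.2 < j.2.+1%:R / 2 ^+ k].

Definition cell (i : nat) (n : 'I_(nelt D)) (k : nat)
    (j : 'I_(2 ^ k) * 'I_(2 ^ k)) : element :=
  (G i n @` subsquare j,
   [set f | exists2 P, poly_Q p P &
              forall z, subsquare j z -> f (G i n z) = P z]).

Definition mesh (l : nat) : set element :=
  \bigcup_(i in [set i | (i <= l)%N]) \bigcup_n
    range (fun j => @cell i n (l - i) j).

(* The cap omega_*^(l+1), which is also the interior of the closure of the
   union of the annuli of index at least l + 1 when Omega is the interior of
   its closure. *)
Definition cap (l : nat) : set (plane R) :=
  scale_set (lambda D ^+ l.+1) (Omega D).

Definition cap_element (capS : nat -> set (plane R -> R)) (l : nat) : element :=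
  (cap l, capS l).

Definition mesh_star (capS : nat -> set (plane R -> R)) (l : nat) :
    set element :=
  mesh l `|` [set cap_element capS l].

(* A finite-dimensional space of functions on U, with elements extended
   arbitrarily outside U. *)
Definition fin_dim_on (U : set (plane R)) (V : set (plane R -> R)) :=
  exists (m : nat) (e : 'I_m -> plane R -> R),
    V = [set f | exists c : 'I_m -> R,
                   forall z, U z -> f z = \sum_(i < m) c i * e i z].

Definition discrete_space (theta : set (plane R)) (Theta : set element) :
    set (plane R -> R) :=
  [set f | L2 theta f /\ forall w, Theta w -> w.2 f].

Definition broken_seminorm (r : nat) (Theta : set element) (f : plane R -> R) :
    \bar R :=
  sqrte (\esum_(w in Theta) sobolev_semi_sq r w.1 f).

Definition is_min (A : set nat) (k : nat) :=
  A k /\ forall j, A j -> (k <= j)%N.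

(* k is the reproduction degree kappa[omega] of w = (omega, S[p; omega]). *)
Definition repro_degree (w : element) (k : nat) :=
  poly_P k `<=` w.2 /\ forall j, poly_P j `<=` w.2 -> (j <= k)%N.

Definition is_kappa0 (k0 : nat) :=
  is_min [set k | exists2 w, mesh 0 w & repro_degree w k] k0.

Definition error_ratio (capS : nat -> set (plane R -> R)) (r : nat)
    (f : plane R -> R) : \bar R :=
  (ereal_inf [set broken_seminorm r (mesh_star capS 0) (f \- fh)%R
     | fh in discrete_space (Omega D) (mesh_star capS 0)]
   / sobolev_norm p.+1 (Omega D) f)%E.

Definition Linf_dist (theta : set (plane R)) (Theta : set element)
    (f : plane R -> R) : \bar R :=
  ereal_inf [set Linf_norm theta (f \- fh)%R | fh in discrete_space theta Theta].

End discretization.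

(* Main.v *)
Require Import Defs.
From mathcomp Require Import all_boot all_order all_algebra.
From mathcomp Require Import all_classical all_reals all_analysis.
From mathcomp Require Import measurable_realfun ess_sup_inf ring lra polyXY.
Import Order.TTheory GRing.Theory Num.Theory.
Import numFieldNormedType.Exports.
Local Open Scope classical_set_scope.
Local Open Scope ring_scope.

Set Implicit Arguments.
Unset Strict Implicit.
Unset Printing Implicit Defensive.

(** The two terms of the maximum are bounded separately.

    The first one comes from the innermost ring [annulus l] covered by the mesh
    of level [l]. There the mesh is not refined, so it is the image of the
    coarse mesh of [annulus 0] under the scaling by [lambda ^ l]. As [phi] is
    homogeneous of degree [k0 + 1], an approximation of [phi] on [annulus l]
    with error [M] rescales to one on [annulus 0] with error
    [M / lambda ^ (l * (k0 + 1))], which is at least the coarse best error [C0]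
    ([scaling_lower_bound]).

    The second one comes from the outermost ring [annulus 0], whose elements
    are subdivided [l] times. As [C0 > 0], on some element the pullback
    [phi \o G 0 n] is a polynomial outside [Q^p], hence has degree greater
    than [p] in one variable along some line. Its derivative of order [p + 1]
    along this line is bounded away from zero near one point, while that of the
    approximation vanishes on each subsquare. Comparing finite differences of
    order [p + 1] whose step is proportional to [1 / 2 ^ l] gives the error
    [c0 / 2 ^ (l * (p + 1))] on one subsquare
    ([dyadic_approximation_lower_bound], [dyadic_square_lower_bound],
    [refinement_lower_bound]).

    Both arguments use that an essential bound on the error over an element is
    a pointwise bound ([element_error_le]). The error is continuous in the
    reference coordinates only, so one needs that the parameterizations map
    nonempty open sets to sets with interior points; [image_contains_box]
    derives this from injectivity and the nonvanishing Jacobian determinant. *)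

(** * Polynomial functions on the plane *)

Section plane_polynomials.
Context {R : realType}.

(** Polynomial functions of two variables are generated by their operations, so
    that continuity, measurability and differentiability go by induction. *)
Inductive polyfun : (plane R -> R) -> Prop :=
| polyfun_cst c : polyfun (fun=> c)
| polyfun_fst : polyfun (fun z => z.1)
| polyfun_snd : polyfun (fun z => z.2)
| polyfun_add f g : polyfun f -> polyfun g -> polyfun (fun z => f z + g z)
| polyfun_mul f g : polyfun f -> polyfun g -> polyfun (fun z => f z * g z).

Lemma polyfun_sub f g : polyfun f -> polyfun g -> polyfun (fun z => f z - g z).
Proof.
move=> Pf Pg; rewrite (_ : (fun z => _) = (fun z => f z + (fun=> -1) z * g z)).
  by apply: polyfun_add => //; apply: polyfun_mul => //; exact: polyfun_cst.
by apply/funext => z; rewrite mulN1r.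
Qed.

Lemma polyfun_exp f k : polyfun f -> polyfun (fun z => f z ^+ k).
Proof.
move=> Pf; elim: k => [|k IH].
  rewrite (_ : (fun z => _) = fun=> 1); first exact: polyfun_cst.
  by apply/funext => z; rewrite expr0.
rewrite (_ : (fun z => _) = (fun z => f z * f z ^+ k)); first exact: polyfun_mul.
by apply/funext => z; rewrite exprS.
Qed.

Lemma polyfun_sum (I : Type) (r : seq I) (P : pred I) (F : I -> plane R -> R) :
  (forall i, polyfun (F i)) -> polyfun (fun z => \sum_(i <- r | P i) F i z).
Proof.
move=> PF; elim: r => [|i r IH].
  rewrite (_ : (fun z => _) = fun=> 0); first exact: polyfun_cst.
  by apply/funext => z; rewrite big_nil.
rewrite (_ : (fun z => _) = (fun z => (if P i then F i z else 0)
                                      + \sum_(i <- r | P i) F i z)).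
  apply: polyfun_add => //; case: (P i) => //; exact: polyfun_cst.
by apply/funext => z; rewrite big_cons; case: (P i); rewrite ?add0r.
Qed.

Lemma polyfun_comp f g h : polyfun f -> polyfun g -> polyfun h ->
  polyfun (fun z => f (g z, h z)).
Proof.
move=> Pf Pg Ph; elim: Pf => [c|//|//|f1 f2 _ P1 _ P2|f1 f2 _ P1 _ P2].
- exact: polyfun_cst.
- exact: polyfun_add.
- exact: polyfun_mul.
Qed.

Lemma polyfun_comp_plane (f : plane R -> R) (F : plane R -> plane R) :
  polyfun f -> polyfun (fst \o F) -> polyfun (snd \o F) -> polyfun (f \o F).
Proof.
move=> Pf P1 P2; rewrite (_ : f \o F = fun z => f ((fst \o F) z, (snd \o F) z)).
  exact: polyfun_comp.
by apply/funext => z /=; rewrite -surjective_pairing.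
Qed.

Lemma poly_Q_polyfun k (f : plane R -> R) : poly_Q k f -> polyfun f.
Proof.
move=> [c fE]; rewrite (funext fE).
apply: polyfun_sum => a; apply: polyfun_sum => b.
apply: polyfun_mul; last exact: polyfun_exp polyfun_snd.
by apply: polyfun_mul; [exact: polyfun_cst|exact: polyfun_exp polyfun_fst].
Qed.

Lemma poly_Pmax_polyfun k (f : plane R -> R) : poly_Pmax k f -> polyfun f.
Proof.
move=> [c fE]; rewrite (funext fE).
apply: polyfun_sum => b.
apply: polyfun_mul; last exact: polyfun_exp polyfun_snd.
by apply: polyfun_mul; [exact: polyfun_cst|exact: polyfun_exp polyfun_fst].
Qed.

Lemma poly_Pmax_homogeneous k (f : plane R -> R) (t : R) z :
  poly_Pmax k f -> f (t *: z) = t ^+ k * f z.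
Proof.
move=> [c fE]; rewrite !fE mulr_sumr; apply: eq_bigr => b _ /=.
have -> : t ^+ k = t ^+ (k - b) * t ^+ b by rewrite -exprD subnK // -ltnS.
rewrite /= /GRing.scale /= !exprMn.
by ring.
Qed.

Lemma polyfun_continuous f : polyfun f -> continuous f.
Proof.
elim=> [c|||f1 f2 _ P1 _ P2|f1 f2 _ P1 _ P2] z.
- exact: cst_continuous.
- exact: cvg_fst.
- exact: cvg_snd.
- by apply: cvgD; [exact: P1|exact: P2].
- by apply: cvgM; [exact: P1|exact: P2].
Qed.

Lemma polyfun_measurable f (D : set (plane R)) : polyfun f -> measurable_fun D f.
Proof.
elim=> [c|||f1 f2 _ P1 _ P2|f1 f2 _ P1 _ P2].
- exact: measurable_cst.
- apply: (@measurable_funS _ _ _ _ setT) => //; exact: measurable_fst.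
- apply: (@measurable_funS _ _ _ _ setT) => //; exact: measurable_snd.
- exact: measurable_funD.
- exact: measurable_funM.
Qed.

Lemma polyfun_derivable f z (v : plane R) : polyfun f -> derivable f z v.
Proof.
elim=> [c|||f1 f2 _ P1 _ P2|f1 f2 _ P1 _ P2].
- exact: derivable_cst.
- apply/derivable1P.
  by apply: derivableD; [exact: derivableM|exact: derivable_cst].
- apply/derivable1P.
  by apply: derivableD; [exact: derivableM|exact: derivable_cst].
- exact: derivableD.
- exact: derivableM.
Qed.

(** The outer variable of [F] is the second coordinate. *)
Lemma polyfunE f : polyfun f ->
  exists F : {poly {poly R}}, forall z : plane R, f z = F.[z.2%:P].[z.1].
Proof.
elim=> [c|||f1 f2 _ [F FE] _ [H HE]|f1 f2 _ [F FE] _ [H HE]].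
- by exists c%:P%:P => z; rewrite !hornerE.
- by exists ('X)%:P => z; rewrite !hornerE.
- by exists 'X => z; rewrite !hornerE.
- by exists (F + H) => z; rewrite !hornerE FE HE.
- by exists (F * H) => z; rewrite !hornerE FE HE.
Qed.

End plane_polynomials.

(** * Regular polynomial maps are open *)

Section local_openness.
Context {R : realType}.

Lemma derive_dist2 (V : normedModType R) (f g : V -> R) (a b : R) (z h : V) :
  derivable f z h -> derivable g z h ->
  'D_h (fun z => (f z - a) * (f z - a) + (g z - b) * (g z - b)) z =
  2 * ((f z - a) * 'D_h f z + (g z - b) * 'D_h g z).
Proof.
move=> df dg.
have shiftD (k : V -> R) (c : R) : derivable k z h ->
    is_derive z h (fun z => k z - c) ('D_h k z).
  move=> dk; rewrite -[X in is_derive _ _ _ X]subr0.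
  exact: (is_deriveB (g := cst c) (derivableP dk)).
have dF := shiftD f a df; have dG := shiftD g b dg.
have /@derive_val -> := is_deriveD (is_deriveM dF dF) (is_deriveM dG dG).
by rewrite /GRing.scale /=; ring.
Qed.

(** Fermat's rule for directional derivatives: the function is restricted to
    the line through the minimiser. *)
Lemma derive_at_local_min (f : plane R -> R) (z v : plane R) (d : R) :
  polyfun f -> 0 < d ->
  (forall t, `|t| < d -> f z <= f (t *: v + z)) -> 'D_v f z = 0.
Proof.
move=> Pf d0 fmin.
pose h (t : R) := f (t *: v + z).
have quotE t : (fun s : R => s^-1 *: ((f \o shift (t *: v + z)) (s *: v)
                                       - f (t *: v + z)))
    = (fun s : R => s^-1 *: ((h \o shift t) (s *: (1 : R)) - h t)).
  apply/funext => s; rewrite /h /=; congr (_ *: (f _ - f _)).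
  have -> : s *: (1 : R) = s by rewrite /GRing.scale /= mulr1.
  by rewrite scalerDl addrA.
have hder t : derivable h t 1.
  have := @polyfun_derivable _ f (t *: v + z) v Pf.
  by rewrite /derivable quotE.
have h0 : is_derive (0 : R) (1 : R) h 0.
  apply: (@derive1_at_min R h (- d) d 0).
  - lra.
  - by move=> t _; exact: hder.
  - by rewrite in_itv /= oppr_lt0 d0.
  - move=> t; rewrite in_itv /= -ltr_norml => td.
    by rewrite {1}/h scale0r add0r; exact: fmin.
have <- : 'D_(1 : R) h (0 : R) = 0 by exact: derive_val.
by rewrite /derive -(quotE 0) scale0r add0r.
Qed.

Definition rectangle (a b c d : R) : set (plane R) :=
  [set z | a <= z.1 <= b /\ c <= z.2 <= d].

Lemma rectangleE (a b c d : R) :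
  rectangle a b c d = (`[a, b] : set R) `*` (`[c, d] : set R).
Proof. by apply/seteqP; split => z; rewrite /rectangle /= !in_itv. Qed.

Lemma compact_rectangle (a b c d : R) : compact (rectangle a b c d).
Proof. by rewrite rectangleE; apply: compact_setX; exact: segment_compact. Qed.

(** The sides of a square are compact rectangles of width zero. *)
Lemma compact_square_boundary (x y d : R) :
  compact ([set z | `|z.1 - x| <= d /\ `|z.2 - y| <= d
                 /\ (`|z.1 - x| = d \/ `|z.2 - y| = d)] : set (plane R)).
Proof.
have [d0|d0] := ltP d 0.
  rewrite (_ : [set _ | _] = set0); first exact: compact0.
  apply/seteqP; split => z //= [zd _].
  by have := le_lt_trans zd d0; rewrite normr_lt0.
rewrite (_ : [set _ | _] =
    (rectangle (x - d) (x - d) (y - d) (y + d)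
       `|` rectangle (x + d) (x + d) (y - d) (y + d))
    `|` (rectangle (x - d) (x + d) (y - d) (y - d)
       `|` rectangle (x - d) (x + d) (y + d) (y + d))).
  by do 2! (apply: compactU); try (apply: compactU); exact: compact_rectangle.
apply/seteqP; split => z; rewrite /rectangle /= !ler_norml.
  move=> [/andP[? ?] [/andP[? ?] [E|E]]].
  - left; have [s|s] := lerP 0 (z.1 - x).
      by rewrite ger0_norm // in E; right; lra.
    by rewrite ltr0_norm // in E; left; lra.
  - right; have [s|s] := lerP 0 (z.2 - y).
      by rewrite ger0_norm // in E; right; lra.
    by rewrite ltr0_norm // in E; left; lra.
have nE (a : R) : a = d \/ a = - d -> `|a| = d.
  by case=> ->; rewrite ?normrN ger0_norm.
move=> [[] H|[] H]; (split; [lra|split; [lra|]]).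
- by left; apply: nE; right; lra.
- by left; apply: nE; left; lra.
- by right; apply: nE; right; lra.
- by right; apply: nE; left; lra.
Qed.

Definition box (z : plane R) (e : R) : set (plane R) :=
  [set w | `|w.1 - z.1| < e /\ `|w.2 - z.2| < e].

Lemma open_box_nbhs (B : set (plane R)) z : open B -> B z ->
  exists2 d : R, 0 < d & [set w : plane R | `|w.1 - z.1| <= d /\ `|w.2 - z.2| <= d] `<=` B.
Proof.
move=> oB Bz; have /nbhs_ballP[e /= e0 eB] := open_nbhs_nbhs (conj oB Bz).
exists (e / 2); first by rewrite divr_gt0.
move=> w [w1 w2]; apply: eB; split; rewrite /ball /= distrC; lra.
Qed.

(** Local surjectivity without the inverse function theorem. The squared
    distance from [F z] to a target near [F z0] is minimised over a small
    closed square around [z0]; by injectivity the minimum is not on its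
    boundary, so its gradient vanishes there, and the Jacobian matrix being
    invertible the target is attained. *)
Lemma image_contains_box (F : plane R -> plane R) (B : set (plane R)) z0 :
  polyfun (fst \o F) -> polyfun (snd \o F) ->
  open B -> set_inj B F -> (forall z, B z -> jacobian_det F z != 0) -> B z0 ->
  exists2 e, 0 < e & box (F z0) e `<=` F @` B.
Proof.
move=> Pu Pv oB injF jacF Bz0.
pose u : plane R -> R := fst \o F; pose v : plane R -> R := snd \o F.
rewrite -/u in Pu; rewrite -/v in Pv.
have [d d0 dB] := open_box_nbhs oB Bz0.
pose dist2 (w : plane R) := fun z : plane R =>
  (u z - w.1) * (u z - w.1) + (v z - w.2) * (v z - w.2).
have Pdist2 w : polyfun (dist2 w).
  by apply: polyfun_add; apply: polyfun_mul; apply: polyfun_sub => //;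
    exact: polyfun_cst.
have cdist2 w (A : set (plane R)) : {within A, continuous (dist2 w)}.
  exact/continuous_subspaceT/polyfun_continuous.
pose K : set (plane R) := [set w | `|w.1 - z0.1| <= d /\ `|w.2 - z0.2| <= d].
pose bK : set (plane R) := [set z | `|z.1 - z0.1| <= d /\ `|z.2 - z0.2| <= d
                 /\ (`|z.1 - z0.1| = d \/ `|z.2 - z0.2| = d)].
have Kz0 : K z0 by rewrite /K /= !subrr normr0 ltW.
have cK : compact K.
  rewrite (_ : K = rectangle (z0.1 - d) (z0.1 + d) (z0.2 - d) (z0.2 + d)).
    exact: compact_rectangle.
  by apply/seteqP; split => z; rewrite /K /rectangle /= !ler_norml => H; lra.
have bK0 : bK !=set0.
  by exists (z0.1 + d, z0.2); rewrite /bK /= addrAC subrr add0r gtr0_norm//;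
    rewrite subrr normr0; do !split => //; [exact: ltW|left].
have [zb] := compact_EVT_min bK0 (@compact_square_boundary z0.1 z0.2 d)
                (cdist2 (F z0) bK).
rewrite inE => -[zb1 [zb2 zb3]] zbmin.
set c := dist2 (F z0) zb in zbmin.
have c0 : 0 < c.
  have zbz0 : zb != z0.
    apply/eqP => zbE; move: zb3; rewrite zbE !subrr normr0 => -[] E;
    by rewrite -E ltxx in d0.
  have : F zb != F z0.
    apply: contra zbz0 => /eqP FE; apply/eqP; apply: injF => //.
      by rewrite inE; apply: dB.
    by rewrite inE.
  rewrite /c /dist2 /u /v /=; case: (F zb) (F z0) => [a1 a2] [b1 b2] /= ab.
  rewrite lt_neqAle addr_ge0 -?expr2 ?sqr_ge0// andbT eq_sym paddr_eq0 ?sqr_ge0//.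
  rewrite !sqrf_eq0 !subr_eq0; apply: contra ab => /andP[/eqP -> /eqP ->] //.
(* e <= 1 gives e ^+ 2 <= e <= c / 8, so that 2 e ^+ 2 <= c / 4. *)
pose e := Num.min 1 (c / 8).
have e0 : 0 < e by rewrite lt_min ltr01 divr_gt0.
have e1 : e <= 1 by rewrite ge_min lexx.
have ec : e <= c / 8 by rewrite ge_min lexx orbT.
exists e => // w [we1 we2].
have dz0 : dist2 w z0 < c / 4.
  have sq (a : R) : `|a| < e -> a * a < e.
    by rewrite ltr_norml => /andP[a1 a2]; nra.
  have /= h1 := sq (u z0 - w.1); have /= h2 := sq (v z0 - w.2).
  rewrite distrC in we1; rewrite distrC in we2.
  by have := h1 we1; have := h2 we2; rewrite /dist2; lra.
have [zs] := compact_EVT_min (ex_intro _ z0 Kz0) cK (cdist2 w K).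
rewrite inE => -[zs1 zs2] zsmin.
have zsz0 : dist2 w zs < c / 4.
  by apply: le_lt_trans dz0; apply: zsmin; rewrite inE.
(* On the boundary, c <= dist2 (F z0) zs <= 2 (dist2 w zs + dist2 w z0) < c. *)
have nbKzs : ~ (`|zs.1 - z0.1| = d \/ `|zs.2 - z0.2| = d).
  move=> zs3; have : c <= dist2 (F z0) zs by apply: zbmin; rewrite inE.
  move: zsz0 dz0; rewrite /dist2 /=.
  rewrite -[(F z0).1]/(u z0) -[(F z0).2]/(v z0).
  move: (u zs) (v zs) (u z0) (v z0) (w.1) (w.2) => a b a0 b0 w1 w2 A1 A2 A3.
  have := sqr_ge0 (a - w1 + (a0 - w1)); have := sqr_ge0 (b - w2 + (b0 - w2)).
  by rewrite !expr2; nra.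
have {}zs1 : `|zs.1 - z0.1| < d.
  by rewrite lt_neqAle zs1 andbT; apply/eqP => E; apply: nbKzs; left.
have {}zs2 : `|zs.2 - z0.2| < d.
  by rewrite lt_neqAle zs2 andbT; apply/eqP => E; apply: nbKzs; right.
have Bzs : B zs by apply: dB; split; exact: ltW.
have grad (h : plane R) : `|h.1| <= 1 -> `|h.2| <= 1 ->
    (u zs - w.1) * 'D_h u zs + (v zs - w.2) * 'D_h v zs = 0.
  move=> h1 h2.
  pose d' := Num.min (d - `|zs.1 - z0.1|) (d - `|zs.2 - z0.2|).
  have d'0 : 0 < d' by rewrite lt_min !subr_gt0 zs1.
  have : 'D_h (dist2 w) zs = 0.
    apply: (derive_at_local_min (d := d')) => // t td.
    apply: zsmin; rewrite inE /K /=.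
    have d'1 : d' <= d - `|zs.1 - z0.1| by rewrite ge_min lexx.
    have d'2 : d' <= d - `|zs.2 - z0.2| by rewrite ge_min lexx orbT.
    have t0 := normr_ge0 t.
    split; rewrite -addrA (le_trans (ler_normD _ _))// normrM.
      by have := normr_ge0 h.1; nra.
    by have := normr_ge0 h.2; nra.
  rewrite /dist2 derive_dist2; try exact: polyfun_derivable.
  by move=> H; lra.
(* Cramer's rule for the vanishing gradient. *)
have gx := grad (1, 0); have gy := grad (0, 1).
rewrite /= normr1 normr0 lexx ler01 in gx gy.
have {}gx := gx isT isT; have {}gy := gy isT isT.
have := jacF _ Bzs; rewrite /jacobian_det /pdx /pdy -/u -/v.
move: gx gy; set ux := 'D__ u zs; set vx := 'D__ v zs.
set uy := 'D__ u zs; set vy := 'D__ v zs => gx gy jac.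
exists zs => //.
have ea : (u zs - w.1) * (ux * vy - uy * vx) = 0.
  have -> : (u zs - w.1) * (ux * vy - uy * vx) =
   ((u zs - w.1) * ux + (v zs - w.2) * vx) * vy
   - ((u zs - w.1) * uy + (v zs - w.2) * vy) * vx by ring.
  by rewrite gx gy !mul0r subrr.
have eb : (v zs - w.2) * (ux * vy - uy * vx) = 0.
  have -> : (v zs - w.2) * (ux * vy - uy * vx) =
   ((u zs - w.1) * uy + (v zs - w.2) * vy) * ux
   - ((u zs - w.1) * ux + (v zs - w.2) * vx) * uy by ring.
  by rewrite gx gy !mul0r subrr.
move/eqP: ea; rewrite mulf_eq0 (negbTE jac) orbF subr_eq0 => /eqP ea.
move/eqP: eb; rewrite mulf_eq0 (negbTE jac) orbF subr_eq0 => /eqP eb.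
by rewrite [LHS]surjective_pairing [RHS]surjective_pairing -ea -eb.
Qed.

End local_openness.

(** * Lebesgue measure and essential suprema on the plane *)

Section measure_on_the_plane.
Context {R : realType}.

(** The sigma-algebra is the product of the Borel sigma-algebras, so an open
    set has to be written as a countable union of products. *)
Lemma open_plane_measurable (U : set (plane R)) : open U -> measurable U.
Proof.
move=> oU.
pose I := ((rat * rat) * (rat * rat))%type.
pose rect (i : I) : set (plane R) :=
  ball (ratr i.1.1 : R) (ratr i.1.2 : R) `*` ball (ratr i.2.1 : R) (ratr i.2.2 : R).
rewrite (_ : U = \bigcup_(i in [set i | rect i `<=` U]) rect i).
  rewrite bigcup_mkcond; apply: countable_bigcupT_measurable => [|i].
    exact: countableP.
  case: ifP => // _.
  by apply: measurableX; exact: measurable_ball.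
apply/seteqP; split; last by move=> z [i iU]; exact: iU.
move=> z Uz; have [[A B] /= [Az Bz] AB] := open_nbhs_nbhs (conj oU Uz).
have zA : z.1 \in (A° : set R) by rewrite inE; exact: Az.
have zB : z.2 \in (B° : set R) by rewrite inE; exact: Bz.
have [c1 [r1 /= [cr1 sub1]]] := open_subball_rat (@open_interior R A) zA.
have [c2 [r2 /= [cr2 sub2]]] := open_subball_rat (@open_interior R B) zB.
exists ((c1, r1), (c2, r2)).
  by move=> w [/= /sub1 w1 /sub2 w2]; apply: AB; split; exact: interior_subset.
by split; [move: cr1|move: cr2]; rewrite inE.
Qed.

Lemma rectangle_measurable (a b c d : R) : measurable (rectangle a b c d).
Proof. by rewrite rectangleE; apply: measurableX; exact: measurable_itv. Qed.

Lemma leb2_rectangle (a b c d : R) : a < b -> c < d ->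
  leb2 R (rectangle a b c d) = ((b - a) * (d - c))%:E.
Proof.
move=> ab cd; rewrite rectangleE.
rewrite [LHS]product_measure1E; try exact: measurable_itv.
have itvE (x y : R) : x < y -> lebesgue_measure (`[x, y] : set R) = (y - x)%:E.
  by move=> xy; rewrite lebesgue_measure_itv /= lte_fin xy -EFinB.
by rewrite EFinM -!itvE.
Qed.

Lemma leb2_box_gt0 (z : plane R) (e : R) (N : set (plane R)) :
  measurable N -> 0 < e -> box z e `<=` N -> (0 < leb2 R N)%E.
Proof.
move=> mN e0 eN.
have sub : rectangle (z.1 - e / 2) (z.1 + e / 2) (z.2 - e / 2) (z.2 + e / 2) `<=` N.
  move=> w [/= w1 w2]; apply: eN.
  by split; rewrite ltr_norml; lra.
have rect0 : (0 < leb2 R (rectangle (z.1 - e / 2) (z.1 + e / 2)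
                                    (z.2 - e / 2) (z.2 + e / 2)))%E.
  rewrite leb2_rectangle; [|lra..].
  by rewrite lte_fin mulr_gt0 //; lra.
apply: (lt_le_trans rect0); apply: le_measure => //; rewrite inE //.
exact: rectangle_measurable.
Qed.

Lemma leb2_setT_gt0 : (0 < leb2 R setT)%E.
Proof. by apply: (@leb2_box_gt0 0 1). Qed.

Lemma Linf_norm_le (U : set (plane R)) (f : plane R -> R) (M : R) : 0 <= M ->
  (forall z, U z -> `|f z| <= M) -> (Linf_norm U f <= M%:E)%E.
Proof.
move=> M0 fM; rewrite /Linf_norm unlock /= leb2_setT_gt0.
apply/ess_supP; apply: nearW => z /=; rewrite lee_fin patchE.
by case: ifPn => [|_]; rewrite ?normr0 // inE; exact: fM.
Qed.

(** A bound on the essential supremum holds on a dense set of points, because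
    an open set has positive measure unless it is empty. *)
Lemma Linf_norm_dense (U : set (plane R)) (f : plane R -> R) (M : R) z e :
  (Linf_norm U f <= M%:E)%E -> 0 < e -> box z e `<=` U ->
  exists2 w, box z e w & `|f w| <= M.
Proof.
rewrite /Linf_norm unlock /= leb2_setT_gt0 => /ess_supP [N [mN N0 fN]] e0 eU.
apply: contrapT => nex.
have : (0 < leb2 R N)%E.
  apply: (@leb2_box_gt0 z e N mN e0) => w ew; apply: fN => /=.
  rewrite lee_fin patchE (mem_set (eU _ ew)).
  by move=> fw; apply: nex; exists w.
by rewrite N0 ltxx.
Qed.

Lemma bounded_L2 (U : set (plane R)) (f : plane R -> R) (M b : R) :
  measurable U -> measurable_fun U f ->
  (forall z, U z -> `|z.1| <= b /\ `|z.2| <= b) ->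
  (forall z, U z -> `|f z| <= M) -> L2 U f.
Proof.
move=> mU mf Ub fM; split=> //.
rewrite unlock /=; apply: poweR_lty.
have [->|/set0P[z0 Uz0]] := eqVneq U set0.
  rewrite integral0_eq ?ltry // => z _.
  rewrite patchE in_set0 normr0. by rewrite powR0 ?pnatr_eq0.
have M0 : 0 <= M by exact: le_trans (normr_ge0 _) (fM z0 Uz0).
have b0 : 0 <= b by have [h _] := Ub _ Uz0; exact: le_trans (normr_ge0 _) h.
pose Q : set (plane R) := rectangle (- (b + 1)) (b + 1) (- (b + 1)) (b + 1).
have mQ : measurable Q by exact: rectangle_measurable.
have UQ : U `<=` Q.
  move=> z /Ub[]; rewrite !ler_norml => ? ?.
  by split => /=; lra.
have mfU : measurable_fun setT (f \_ U).
  by apply/(measurable_restrictT f mU).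
apply: (@le_lt_trans _ _ (\int[leb2 R]_(z in setT) ((cst (M `^ 2)%:E) \_ Q) z)%E).
  apply: ge0_le_integral => //.
  - apply/measurable_EFinP; apply: (measurableT_comp (measurable_powR _)).
    exact: measurableT_comp.
  - apply/(measurable_restrictT (cst (M `^ 2)%:E) mQ); exact: measurable_cst.
  - move=> z _; rewrite !patchE.
    case: ifPn => [|_].
      rewrite inE => Uz; rewrite mem_set; last exact: UQ.
      by rewrite /= lee_fin ge0_ler_powR ?nnegrE //; exact: fM.
    rewrite /= normr0 powR0 //; case: ifP => // _.
    by rewrite lee_fin powR_ge0.
rewrite -integral_mkcond integral_cst //= leb2_rectangle; [|lra..].
by rewrite -EFinM ltry.
Qed.

End measure_on_the_plane.

(** * Polynomial approximation on dyadic intervals *)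

Section univariate_lower_bound.
Context {R : realType}.

Lemma poly_mvt (g : {poly R}) (a b : R) : a < b ->
  exists2 x, a <= x <= b & g.[b] - g.[a] = g^`().[x] * (b - a).
Proof.
move=> ab.
have [|x] := @MVT R (horner g) (horner g^`()) a b ab.
  exact/continuous_subspaceT/continuous_horner.
by rewrite in_itv /= => /andP[? ?] ->; exists x => //; rewrite !ltW.
Qed.

Lemma derivn_comp_shift (g : {poly R}) (h : R) n :
  (g \Po ('X + h%:P))^`(n) = g^`(n) \Po ('X + h%:P).
Proof.
elim: n => [|n IH]; first by rewrite !derivn0.
by rewrite !derivnS IH deriv_comp derivD derivX derivC addr0 mulr1.
Qed.

(** A finite difference of order [n] and step [h] equals [h ^+ n] times an
    intermediate value of the [n]-th derivative, and is at most [2 ^+ n] times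
    the sup of the function. *)
Lemma derivn_le_sup n : forall (g : {poly R}) (u h M : R), 0 < h ->
  (forall x, u <= x <= u + n%:R * h -> `|g.[x]| <= M) ->
  exists2 x, u <= x <= u + n%:R * h & `|g^`(n).[x]| * h ^+ n <= 2 ^+ n * M.
Proof.
elim: n => [|n IH] g u h M h0 gM.
  exists u; first by rewrite mul0r addr0 lexx.
  by rewrite derivn0 !expr0 mulr1 mul1r gM // mul0r addr0 lexx.
have nS : n.+1%:R = n%:R + 1 :> R by rewrite -natr1.
have nh0 : 0 <= n%:R * h by rewrite mulr_ge0 ?ler0n // ltW.
have [|x xu gx] := IH (g \Po ('X + h%:P) - g) u h (2 * M) h0.
  move=> x xu; rewrite !hornerE horner_comp !hornerE.
  have /gM g1 : u <= x + h <= u + n.+1%:R * h by rewrite nS; lra.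
  have /gM g2 : u <= x <= u + n.+1%:R * h by rewrite nS; lra.
  by apply: le_trans (ler_normB _ _) _; lra.
have [|y yx gy] := @poly_mvt g^`(n) x (x + h); first lra.
exists y; first by rewrite nS; lra.
move: gx; rewrite derivnB derivn_comp_shift !hornerE horner_comp !hornerE.
rewrite gy -derivnS addrAC subrr add0r normrM (gtr0_norm h0).
by rewrite exprS [2 ^+ n.+1]exprSr !mulrA /=.
Qed.

Lemma nonroot_in_unit_interval (q : {poly R}) : q != 0 ->
  exists2 x, 0 < x < 1 & q.[x] != 0.
Proof.
move=> q0; apply: contrapT => nex.
pose s := [seq (i.+2%:R : R)^-1 | i <- iota 0 (size q)].
have : (size s < size q)%N.
  apply: max_poly_roots => //.
    apply/allP => _ /mapP[i _ ->]; apply: contrapT => /negP nr.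
    apply: nex; exists (i.+2%:R^-1) => //.
    by rewrite invr_gt0 ltr0n /= invf_lt1 ?ltr0n // ltr1n.
  rewrite map_inj_uniq ?iota_uniq // => i j /invr_inj /eqP.
  by rewrite eqr_nat => /eqP [].
by rewrite size_map size_iota ltnn.
Qed.

Lemma dyadic_interval (x : R) l : 0 < x < 1 ->
  exists j : 'I_(2 ^ l), j%:R / 2 ^+ l <= x <= j.+1%:R / 2 ^+ l.
Proof.
move=> /andP[x0 x1].
have l0 : (0 : R) < 2 ^+ l by rewrite exprn_gt0.
have := truncn_itv (ltW (mulr_gt0 x0 l0)).
set k := Num.truncn _ => /andP[k1 k2].
have kl : (k < 2 ^ l)%N.
  rewrite -(ltr_nat R) natrX; apply: le_lt_trans k1 _.
  by rewrite gtr_pMl.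
exists (Ordinal kl) => /=.
by rewrite ler_pdivrMr // ler_pdivlMr // k1 ltW.
Qed.

(** Polynomials of degree less than [n] approximate one of degree at least [n]
    no better than at the rate [h ^ n] on some interval of each dyadic
    subdivision, because its [n]-th derivative is bounded away from zero near
    one point of the unit interval. *)
Lemma dyadic_approximation_lower_bound (q : {poly R}) n : (n < size q)%N ->
  exists2 c : R, 0 < c & forall l, exists j : 'I_(2 ^ l),
    forall (P : {poly R}) M, (size P <= n)%N ->
    (forall x, j%:R / 2 ^+ l <= x <= j.+1%:R / 2 ^+ l -> `|q.[x] - P.[x]| <= M) ->
    c * (1 / 2 ^+ (l * n)) <= M.
Proof.
move=> nq.
have qn0 : q^`(n) != 0.
  apply/eqP => /(congr1 (fun r : {poly R} => r`_((size q).-1 - n))).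
  rewrite coef0 coef_derivn subnKC; last by rewrite -ltnS prednK // (leq_trans _ nq).
  move/eqP; rewrite mulrn_eq0 lead_coef_eq0 => /orP[|/eqP q0].
    by rewrite -leqn0 leqNgt ffact_gt0 -ltnS prednK ?nq // (leq_trans _ nq).
  by rewrite q0 size_poly0 in nq.
have [x0 x01 qx0] := nonroot_in_unit_interval qn0.
pose A := `|q^`(n).[x0]|.
have A0 : 0 < A by rewrite normr_gt0.
have [d d0 qd] : exists2 d : R, 0 < d &
    forall x, `|x - x0| < d -> A / 2 <= `|q^`(n).[x]|.
  have A20 : 0 < A / 2 by rewrite divr_gt0.
  have /cvgrPdist_lt /(_ _ A20) := @continuous_horner R q^`(n) x0.
  move=> /nbhs_ballP[d /= d0 dq].
  exists d => // x xd; have /dq : ball x0 d x by rewrite /ball /= distrC.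
  move=> /=; have := ler_dist_dist q^`(n).[x0] q^`(n).[x].
  rewrite -/A => H1 H2; have := ler_norm (A - `|q^`(n).[x]|); lra.
pose d1 := Num.min (d / 2) 1.
have d10 : 0 < d1 by rewrite lt_min divr_gt0 /=.
have d11 : d1 <= 1 by rewrite ge_min lexx orbT.
have d1d : d1 < d by rewrite gt_min; apply/orP; left; lra.
have n0 : (0 : R) < n.+1%:R by rewrite ltr0n.
exists (A / 2 * (d1 / n.+1%:R) ^+ n / 2 ^+ n).
  by rewrite !mulr_gt0 ?exprn_gt0 ?invr_gt0 ?exprn_gt0 ?mulr_gt0 ?invr_gt0.
move=> l; have [j] := dyadic_interval l x01.
exists j => P M sP; move: p.
set a := _ / _; set b := _ / _ => /andP[ax bx] PM.
pose s : R := (2 ^+ l)^-1.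
have s0 : 0 < s by rewrite invr_gt0 exprn_gt0.
have ba : b = a + s by rewrite /b -natr1 mulrDl mul1r.
(* The part of the dyadic interval where the derivative is controlled; it
   contains x0 and has length at least d1 * s. *)
pose u := Num.max a (x0 - d1); pose v := Num.min b (x0 + d1).
have au : a <= u by rewrite le_max lexx.
have du : x0 - d1 <= u by rewrite le_max lexx orbT.
have vb : v <= b by rewrite ge_min lexx.
have vd : v <= x0 + d1 by rewrite ge_min lexx orbT.
have s1 : s <= 1 by rewrite invf_le1 ?exprn_gt0 // exprn_ege1 // ler1n.
have uv : d1 * s <= v - u.
  have ds1 : d1 * s <= d1 by rewrite ler_piMr // ltW.
  have ds2 : d1 * s <= s by rewrite ler_piMl // ltW.
  by rewrite /u /v; case: (leP a) => ?; case: (leP b) => ?; lra.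
(* n.+1 rather than n, so that the step is positive when n = 0. *)
pose h := d1 * s / n.+1%:R.
have h0 : 0 < h by rewrite divr_gt0 // mulr_gt0.
have nh : n%:R * h <= d1 * s.
  rewrite /h mulrA ler_pdivrMr // mulrC ler_pM2l ?mulr_gt0 //.
  by rewrite ler_nat.
have [|x xu] := @derivn_le_sup n (q - P) u h M h0.
  by move=> x xu; rewrite !hornerE; apply: PM; lra.
rewrite derivnB (derivn_poly0 sP) subr0 => qxM.
have /qd qx : `|x - x0| < d by rewrite ltr_norml; lra.
have hE : h ^+ n = (d1 / n.+1%:R) ^+ n * (1 / 2 ^+ (l * n)).
  by rewrite /h mulrAC exprMn /s -exprVn -exprM exprVn mul1r.
have hn0 : 0 < h ^+ n by rewrite exprn_gt0.
have tn0 : (0 : R) < 2 ^+ n by rewrite exprn_gt0.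
have -> : A / 2 * (d1 / n.+1%:R) ^+ n / 2 ^+ n * (1 / 2 ^+ (l * n))
    = A / 2 * h ^+ n / 2 ^+ n by rewrite hE; ring.
rewrite ler_pdivrMr // [M * _]mulrC; apply: le_trans qxM.
by rewrite ler_pM2r.
Qed.

End univariate_lower_bound.

(** * Polynomial approximation on dyadic squares *)

Section bivariate_lower_bound.
Context {R : realType}.

Lemma polyfun_bounded (f : plane R -> R) b : polyfun f ->
  exists2 M, 0 <= M & forall z : plane R, `|z.1| <= b -> `|z.2| <= b -> `|f z| <= M.
Proof.
elim=> [c|||f1 f2 _ [M1 M10 H1] _ [M2 M20 H2]|f1 f2 _ [M1 M10 H1] _ [M2 M20 H2]].
- by exists `|c|.
- by exists `|b| => // z zb _; exact: le_trans (ler_norm b).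
- by exists `|b| => // z _ zb; exact: le_trans (ler_norm b).
- exists (M1 + M2) => [|z z1 z2]; first exact: addr_ge0.
  by rewrite (le_trans (ler_normD _ _)) // lerD ?H1 ?H2.
- exists (M1 * M2) => [|z z1 z2]; first exact: mulr_ge0.
  by rewrite normrM ler_pM ?H1 ?H2.
Qed.

Lemma polyfun_gt_open (f : plane R -> R) M : polyfun f ->
  open [set z | M < `|f z|].
Proof.
move=> Pf; rewrite (_ : [set _ | _] = (fun z => `|f z|) @^-1` [set x | M < x]) //.
apply: open_comp; last exact: open_gt.
move=> z _; apply: (@continuous_comp _ _ _ f (fun x : R => `|x|)); last exact: norm_continuous.
exact: polyfun_continuous.
Qed.

Lemma approach_from_inside (a b x e : R) : a < b -> a <= x <= b -> 0 < e ->
  exists2 y, a < y < b & `|y - x| < e.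
Proof.
move=> ab xab e0; pose t := Num.min (e / 2) ((b - a) / 4).
have t0 : 0 < t by rewrite lt_min !divr_gt0 // subr_gt0.
have te : t <= e / 2 by rewrite ge_min lexx.
have tb : t <= (b - a) / 4 by rewrite ge_min lexx orbT.
have [xm|xm] := leP x ((a + b) / 2).
  by exists (x + t); [lra|rewrite ltr_norml; lra].
by exists (x - t); [lra|rewrite ltr_norml; lra].
Qed.

Lemma polyfun_le_closed_rectangle (f : plane R -> R) (a b c d M : R) :
  polyfun f -> a < b -> c < d ->
  (forall z : plane R, a < z.1 < b /\ c < z.2 < d -> `|f z| <= M) ->
  forall z, rectangle a b c d z -> `|f z| <= M.
Proof.
move=> Pf ab cd fM z [z1 z2]; rewrite leNgt; apply/negP => Mz.
have [e e0 eM] := open_box_nbhs (@polyfun_gt_open f M Pf) Mz.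
have [x xab xz] := approach_from_inside ab z1 e0.
have [y ycd yz] := approach_from_inside cd z2 e0.
have /= := eM (x, y) (conj (ltW xz) (ltW yz)).
by rewrite ltNge fM.
Qed.

Lemma poly_Q_vertical_slice p (P : plane R -> R) x : poly_Q p P ->
  exists2 q : {poly R}, (size q <= p.+1)%N & forall y, P (x, y) = q.[y].
Proof.
move=> [c PE].
exists (\poly_(b < p.+1) \sum_(a < p.+1) c a (inord b) * x ^+ a).
  exact: size_poly.
move=> y; rewrite PE horner_poly exchange_big; apply: eq_bigr => b _ /=.
by rewrite mulr_suml inord_val.
Qed.

Lemma poly_Q_swap p (P : plane R -> R) :
  poly_Q p P -> poly_Q p (fun z => P (z.2, z.1)).
Proof.
move=> [c PE]; exists (fun a b => c b a) => z.
rewrite PE exchange_big; apply: eq_bigr => a _; apply: eq_bigr => b _ /=.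
by rewrite mulrAC.
Qed.

Lemma polyfun_swap (f : plane R -> R) :
  polyfun f -> polyfun (fun z => f (z.2, z.1)).
Proof.
by move=> Pf; apply: polyfun_comp => //; [exact: polyfun_snd|exact: polyfun_fst].
Qed.

(** Outside [Q^p] the degree exceeds [p] in one of the two variables; the
    coefficient of the corresponding power is a nonzero polynomial in the other
    variable, so it survives on some line through the unit square. *)
Lemma polyfun_high_degree_slice p (f : plane R -> R) :
  polyfun f -> ~ poly_Q p f ->
  exists x (q : {poly R}), [/\ 0 < x < 1, (p.+1 < size q)%N &
    (forall y, f (x, y) = q.[y]) \/ (forall y, f (y, x) = q.[y])].
Proof.
move=> /polyfunE[F FE] nQ.
have slice (H : {poly {poly R}}) b : (p < b)%N -> H`_b != 0 ->
    exists x (q : {poly R}), [/\ 0 < x < 1, (p.+1 < size q)%N &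
      forall y, H.[y%:P].[x] = q.[y]].
  move=> pb Hb; have [x x01 Hbx] := nonroot_in_unit_interval Hb.
  exists x, (map_poly (horner_eval x) H); split=> //.
    rewrite (leq_ltn_trans pb) //; apply: contraNltn Hbx => sH.
    by rewrite -/(horner_eval x _) -coef_map nth_default.
  move=> y; rewrite -[LHS]/(horner_eval x _) -horner_map /=.
  by rewrite /horner_eval hornerC.
have [[b [pb Fb]]|noF2] := pselect (exists b, (p < b)%N /\ F`_b != 0).
  have [x [q [x01 pq qE]]] := slice F b pb Fb.
  by exists x, q; split=> //; left => y; rewrite FE /= qE.
have [[a [pa Fa]]|noF1] := pselect (exists a, (p < a)%N /\ (swapXY F)`_a != 0).
  have [x [q [x01 pq qE]]] := slice (swapXY F) a pa Fa.
  exists x, q; split=> //; right => y.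
  by rewrite FE /= -qE horner2_swapXY.
exfalso; apply: nQ.
exists (fun a b => F`_b`_a) => z.
have sF : (size F <= p.+1)%N.
  apply/leq_sizeP => b pb; apply: contrapT => /eqP Fb.
  by apply: noF2; exists b.
rewrite FE (horner_coef_wide _ sF) horner_sum exchange_big /=.
apply: eq_bigr => b _.
have sFb : (size (F`_b)%R <= p.+1)%N.
  apply/leq_sizeP => a pa; rewrite -coef_swapXY.
  have -> : (swapXY F)`_a = 0; last by rewrite coef0.
  by apply: contrapT => /eqP Fa; apply: noF1; exists a.
rewrite hornerM -rmorphXn hornerC (horner_coef_wide _ sFb) mulr_suml.
by apply: eq_bigr.
Qed.

Lemma dyadic_endpoints_lt l (j : 'I_(2 ^ l)) :
  (j%:R / 2 ^+ l : R) < j.+1%:R / 2 ^+ l.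
Proof. by rewrite ltr_pM2r ?invr_gt0 ?exprn_gt0 // ltr_nat. Qed.

Lemma vertical_slice_lower_bound p (f : plane R -> R) x (q : {poly R}) :
  polyfun f -> 0 < x < 1 -> (p.+1 < size q)%N -> (forall y, f (x, y) = q.[y]) ->
  exists2 c : R, 0 < c & forall l, exists j : 'I_(2 ^ l) * 'I_(2 ^ l),
    forall P M, poly_Q p P -> (forall z, subsquare j z -> `|f z - P z| <= M) ->
    c * (1 / 2 ^+ (l * p.+1)) <= M.
Proof.
move=> Pf x01 pq fq; have [c c0 cP] := dyadic_approximation_lower_bound pq.
exists c => // l; have [j2 j2P] := cP l; have [j1 j1x] := dyadic_interval l x01.
exists (j1, j2) => P M QP fM.
have [r rp rE] := poly_Q_vertical_slice x QP.
apply: (j2P r) => // y yj; rewrite -fq -rE.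
apply: (@polyfun_le_closed_rectangle (fun z => f z - P z) _ _ _ _ M _
  (dyadic_endpoints_lt j1) (dyadic_endpoints_lt j2) fM); last by split.
by apply: polyfun_sub => //; exact: poly_Q_polyfun QP.
Qed.

Lemma dyadic_square_lower_bound p (f : plane R -> R) :
  polyfun f -> ~ poly_Q p f ->
  exists2 c : R, 0 < c & forall l, exists j : 'I_(2 ^ l) * 'I_(2 ^ l),
    forall P M, poly_Q p P -> (forall z, subsquare j z -> `|f z - P z| <= M) ->
    c * (1 / 2 ^+ (l * p.+1)) <= M.
Proof.
move=> Pf nQ; have [x [q [x01 pq [fq|fq]]]] := polyfun_high_degree_slice Pf nQ.
  exact: vertical_slice_lower_bound fq.
have [c c0 cP] :=
  @vertical_slice_lower_bound p _ x q (polyfun_swap Pf) x01 pq fq.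
exists c => // l; have [j jP] := cP l; exists (j.2, j.1) => P M QP fM.
apply: (jP _ _ (poly_Q_swap QP)) => z [z1 z2].
exact: (fM (z.2, z.1) (conj z2 z1)).
Qed.

End bivariate_lower_bound.

(** * Elements and annuli of a ring domain *)

Section ring_domains.
Context {R : realType} (D : ring_domain R).

Lemma subsquare_sub_unit_square k (j : 'I_(2 ^ k) * 'I_(2 ^ k)) :
  @subsquare R k j `<=` @unit_square R.
Proof.
have k0 : (0 : R) < 2 ^+ k by rewrite exprn_gt0.
have bound (i : 'I_(2 ^ k)) x :
    i%:R / 2 ^+ k < x < i.+1%:R / 2 ^+ k -> (0 : R) < x < 1.
  move=> /andP[x1 x2]; rewrite (le_lt_trans _ x1) ?divr_ge0 ?ler0n ?ltW //=.
  apply: lt_le_trans x2 _; rewrite ler_pdivrMr // mul1r -natrX ler_nat.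
  exact: ltn_ord.
by move=> z [z1 z2]; split; [apply: bound z1|apply: bound z2].
Qed.

Lemma subsquare_level0 k (j : 'I_(2 ^ k) * 'I_(2 ^ k)) : k = 0%N ->
  @subsquare R k j = @unit_square R.
Proof.
move=> k0; subst k; apply/seteqP; split; first exact: subsquare_sub_unit_square.
case: j => j1 j2 z [z1 z2]; rewrite /subsquare /= (ord1 j1) (ord1 j2).
by rewrite !expr0 !divr1 /=.
Qed.

Lemma subsquare_open k (j : 'I_(2 ^ k) * 'I_(2 ^ k)) : open (@subsquare R k j).
Proof.
rewrite (_ : subsquare j =
  (fst @^-1` [set x : R | j.1%:R / 2 ^+ k < x] `&`
   fst @^-1` [set x : R | x < j.1.+1%:R / 2 ^+ k]) `&`
  (snd @^-1` [set x : R | j.2%:R / 2 ^+ k < x] `&`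
   snd @^-1` [set x : R | x < j.2.+1%:R / 2 ^+ k])); last first.
  by apply/seteqP; split=> z; rewrite /subsquare /= => H; lra.
by do !apply: openI; apply: open_comp; try (by move=> z _; exact: cvg_fst);
  try (by move=> z _; exact: cvg_snd); try exact: open_gt; exact: open_lt.
Qed.

(** The error is continuous on each element in the reference coordinates, and
    images of open sets under the parameterization have interior points, so an
    essential bound on the element is a pointwise bound. *)
Lemma element_error_le (theta : set (plane R)) (phi fh P : plane R -> R) p i
    (n : 'I_(nelt D)) k
    (j : 'I_(2 ^ k) * 'I_(2 ^ k)) (M : R) :
  polyfun phi -> poly_Q p P ->
  (forall z, subsquare j z -> fh (G i n z) = P z) ->
  G i n @` subsquare j `<=` theta ->
  (Linf_norm theta (phi \- fh)%R <= M%:E)%E ->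
  forall z, subsquare j z -> `|phi (G i n z) - P z| <= M.
Proof.
move=> Pphi QP fhP sub normM z jz; rewrite leNgt; apply/negP => Mz.
have [/poly_Q_polyfun P1 /poly_Q_polyfun P2] := G_poly i n.
pose B := subsquare j `&` [set z | M < `|phi (G i n z) - P z|].
have oB : open B.
  apply: openI; first exact: subsquare_open.
  apply: (@polyfun_gt_open _ (fun z => phi (G i n z) - P z)).
  apply: polyfun_sub; last exact: poly_Q_polyfun QP.
  exact: (polyfun_comp_plane Pphi P1 P2).
have BU : B `<=` @unit_square R.
  by move=> w [jw _]; exact: subsquare_sub_unit_square jw.
have injB : set_inj B (G i n).
  move=> x y; rewrite !inE => Bx By.
  by apply: G_inj; rewrite inE; exact: BU.
have jacB w : B w -> jacobian_det (G i n) w != 0.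
  by move=> /BU Uw; apply: G_regular; exact: subset_closure.
have [e e0 eB] := image_contains_box P1 P2 oB injB jacB (conj jz Mz).
have esub : box (G i n z) e `<=` theta.
  by move=> w /eB [y [jy _] <-]; apply: sub; exists y.
have [w /eB[y [jy My] <-]] := Linf_norm_dense normM e0 esub.
by rewrite /= (fhP _ jy) leNgt My.
Qed.

Lemma annulus_scaled i m z :
  annulus D i z -> annulus D (m + i) (lambda D ^+ m *: z).
Proof.
move=> Az; elim: m => [|m IH]; first by rewrite expr0 scale1r.
by rewrite addSn annulus_scale; exists (lambda D ^+ m *: z); rewrite // scalerA exprS.
Qed.

(** Up to closure, the cap of level [l] is a union of annuli of index greater
    than [l], and an open annulus is disjoint from the closure of any set that
    it does not meet. *)
Lemma annulus_outside_cap i l : (i <= l)%N ->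
  annulus D i `<=` Omega D `\` closure (cap D l).
Proof.
move=> il z Az; split; first exact: annulus_sub Az.
move=> /(_ _ (open_nbhs_nbhs (conj (@annulus_open _ D i) Az))) [_ [[y Oy <-] Ay]].
pose V := (fun y : plane R => lambda D ^+ l.+1 *: y) @^-1` annulus D i.
have oV : open V.
  apply: open_comp; last exact: annulus_open.
  by move=> w _; exact: scaler_continuous.
have : closure (Omega D) y by exact: subset_closure.
rewrite Omega_closure => /(_ _ (open_nbhs_nbhs (conj oV Ay))) [w [[m _ Aw] Vw]].
have [v [Av Vv]] := Aw _ (open_nbhs_nbhs (conj oV Vw)).
have Av' := annulus_scaled l.+1 Av.
have AA : annulus D i `&` annulus D (l.+1 + m) !=set0.
  by exists (lambda D ^+ l.+1 *: v).
have E := @annulus_disj _ D i (l.+1 + m)%N I I AA.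
by move: il; rewrite E leqNgt addSn ltnS leq_addr.
Qed.

(** An annulus is covered by the closures of finitely many images of the unit
    square under polynomial maps. *)
Lemma annulus_bounded i : exists b : R,
  forall z, annulus D i z -> `|z.1| <= b /\ `|z.2| <= b.
Proof.
have bnd (n : 'I_(nelt D)) : exists b : R, 0 <= b /\
    forall z, closure (G i n @` @unit_square R) z -> `|z.1| <= b /\ `|z.2| <= b.
  have [/poly_Q_polyfun P1 /poly_Q_polyfun P2] := G_poly i n.
  have [b1 b10 H1] := polyfun_bounded 1 P1.
  have [b2 b20 H2] := polyfun_bounded 1 P2.
  exists (b1 + b2); split=> [|z clz]; first exact: addr_ge0.
  have gt_disj (f : plane R -> R) : polyfun f ->
      (forall w, @unit_square R w -> `|f (G i n w)| <= b1 + b2) ->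
      `|f z| <= b1 + b2.
    move=> Pf fb; rewrite leNgt; apply/negP => fz.
    have [_ [[w Uw <-]]] := clz _ (open_nbhs_nbhs (conj (@polyfun_gt_open _ f (b1 + b2) Pf) fz)).
    by rewrite /= ltNge fb.
  have U1 (w : plane R) : unit_square w -> `|w.1| <= 1 /\ `|w.2| <= 1.
    by move=> [? ?]; rewrite !ler_norml; split; lra.
  split; apply: gt_disj; [exact: polyfun_fst| |exact: polyfun_snd|].
    by move=> w /U1[w1 w2]; have := H1 w w1 w2; rewrite /=; lra.
  by move=> w /U1[w1 w2]; have := H2 w w1 w2; rewrite /=; lra.
have [b bP] := choice bnd.
exists (\sum_n b n) => z /subset_closure; rewrite annulus_closure => -[n _ clz].
have [b0 /(_ _ clz)[z1 z2]] := bP n.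
have bn : b n <= \sum_n b n.
  by rewrite (bigD1 n) //= lerDl sumr_ge0 // => m _; have [] := bP m.
by split; apply: le_trans bn.
Qed.

Lemma annulus_L2 i (phi f : plane R -> R) (M : R) :
  polyfun phi -> measurable_fun (annulus D i) f ->
  (forall z, annulus D i z -> `|phi z - f z| <= M) -> L2 (annulus D i) f.
Proof.
move=> Pphi mf fM; have [b bP] := annulus_bounded i.
have [B _ BP] := polyfun_bounded b Pphi.
apply: (@bounded_L2 _ _ f (B + M) b) => //.
  by apply: open_plane_measurable; exact: annulus_open.
move=> z Az; have [z1 z2] := bP _ Az.
have := BP _ z1 z2; have := fM _ Az; rewrite distrC => h1 h2.
rewrite -[f z](subrK (phi z)) (le_trans (ler_normD _ _)) //; lra.
Qed.

End ring_domains.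

(** * The two lower bounds *)

Section lower_bounds.
Context {R : realType} (D : ring_domain R) (p : nat).

Lemma Linf_normP (U : set (plane R)) (f : plane R -> R) :
  Linf_norm U f = +oo%E \/ exists2 M : R, 0 <= M & Linf_norm U f = M%:E.
Proof.
have := Lnorm_ge0 (leb2 R) +oo%E (EFin \o (f \_ U)); rewrite /Linf_norm.
by case: ('N[_]_ _[_])%E => [M| |] // M0; [right; exists M|left].
Qed.

(** Each ring [annulus l] carries the unrefined mesh in the mesh of level [l],
    and is the image of [annulus 0] under a scaling that multiplies [phi] by a
    constant. An approximation of [phi] on the former thus rescales to one on
    the latter. The rescaled function is truncated to be uniformly close to
    [phi]; on the elements this has no effect. *)
Lemma scaling_lower_bound k (phi : plane R -> R) l : poly_Pmax k phi ->
  (Linf_dist (annulus D 0) (mesh D p 0) phi * (lambda D ^+ (l * k))%:E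
   <= Linf_dist (Omega D `\` closure (cap D l)) (mesh D p l) phi)%E.
Proof.
move=> phi_hom; have Pphi := poly_Pmax_polyfun phi_hom.
set theta := _ `\` _.
apply/ereal_infP => _ /= [fh [[mfh _] fhS] <-].
have [->|[M M0 ME]] := Linf_normP theta (phi \- fh); first exact: leey.
have t0 : 0 < lambda D ^+ l by rewrite exprn_gt0 // lambda_gt0.
pose T := lambda D ^+ (l * k).
have T0 : 0 < T by rewrite exprn_gt0 // lambda_gt0.
have TE : T = (lambda D ^+ l) ^+ k by rewrite -exprM.
have MT0 : 0 <= M / T by rewrite divr_ge0 // ltW.
pose gh z := Num.max (phi z - M / T)
  (Num.min (phi z + M / T) (fh (lambda D ^+ l *: z) * T^-1)).
have gh_near z : `|phi z - gh z| <= M / T.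
  rewrite ler_norml /gh; set x := fh _ * _.
  case: (leP (phi z + M / T) x) => ?.
    by case: (leP (phi z - M / T) (phi z + M / T)) => ?; lra.
  by case: (leP (phi z - M / T) x) => ?; lra.
have mtheta : measurable theta.
  apply: measurableD; first by apply: open_plane_measurable; exact: Omega_open.
  rewrite -[closure _]setCK; apply: measurableC; apply: open_plane_measurable.
  by rewrite openC; exact: closed_closure.
have mA : measurable (annulus D 0).
  by apply: open_plane_measurable; exact: annulus_open.
have mscale : measurable_fun (annulus D 0)
    (fun z => fh (lambda D ^+ l *: z)).
  apply: (measurable_comp mtheta _ mfh).
    move=> _ [z Az <-]; apply: (annulus_outside_cap (leqnn l)).
    by rewrite -[l in annulus _ l]addn0; exact: annulus_scaled.
  apply: (@measurable_funS _ _ _ _ setT) => //.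
  apply: (measurable_fun_pair (f := fun z : plane R => lambda D ^+ l * z.1)
                              (g := fun z : plane R => lambda D ^+ l * z.2)).
    exact: polyfun_measurable (polyfun_mul (polyfun_cst _) polyfun_fst).
  exact: polyfun_measurable (polyfun_mul (polyfun_cst _) polyfun_snd).
have mgh : measurable_fun (annulus D 0) gh.
  have mphi c : measurable_fun (annulus D 0) (fun z => phi z + c).
    exact: polyfun_measurable (polyfun_add Pphi (polyfun_cst _)).
  apply: measurable_maxr; first exact: mphi.
  apply: measurable_minr; first exact: mphi.
  by apply: measurable_funM => //; exact: measurable_cst.
have ghS : discrete_space (annulus D 0) (mesh D p 0) gh.
  split; first exact: annulus_L2 Pphi mgh (fun z _ => gh_near z).
  move=> w [i /=]; rewrite leqn0 => /eqP -> [n _ [j _ <-]].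
  have j' : 'I_(2 ^ (l - l)) * 'I_(2 ^ (l - l)) by rewrite subnn; exact: j.
  have wl : mesh D p l (cell p l n j') by exists l => //=; exists n => //; exists j'.
  have [P QP fhP] := fhS _ wl.
  exists (fun z => P z * T^-1).
    have [c cP] := QP; exists (fun a b => c a b * T^-1) => z.
    rewrite cP mulr_suml; apply: eq_bigr => a _; rewrite mulr_suml.
    by apply: eq_bigr => b _; ring.
  move=> z; rewrite subsquare_level0 // => Uz.
  have jz : subsquare j' z by rewrite subsquare_level0 // subnn.
  have sub : G l n @` subsquare j' `<=` theta.
    move=> _ [y jy <-]; apply: (annulus_outside_cap (leqnn l)); apply: elt_sub.
    by exists y => //; exact: subsquare_sub_unit_square jy.
  have le_M : (Linf_norm theta (phi \- fh)%R <= M%:E)%E by rewrite ME.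
  have := element_error_le Pphi QP fhP sub le_M jz.
  rewrite /gh -G_scale (fhP _ jz) G_scale (poly_Pmax_homogeneous _ _ phi_hom) -TE.
  set a := phi _; rewrite ler_norml => aM.
  have [aM1 aM2] : a - M / T <= P z * T^-1 /\ P z * T^-1 <= a + M / T.
    have -> : a - M / T = (T * a - M) * T^-1 by field; rewrite gt_eqF.
    have -> : a + M / T = (T * a + M) * T^-1 by field; rewrite gt_eqF.
    by rewrite !ler_pM2r ?invr_gt0 //; split; lra.
  by rewrite (min_idPr aM2) (max_idPr aM1).
have C0_le : (Linf_dist (annulus D 0) (mesh D p 0) phi <= (M / T)%:E)%E.
  apply: le_trans (ereal_inf_lbound _) _; first by exists gh.
  by apply: Linf_norm_le => // z _; exact: gh_near.
rewrite ME -/T; apply: le_trans (lee_wpmul2r _ C0_le) _.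
  by rewrite lee_fin ltW.
by rewrite -EFinM mulfVK // gt_eqF.
Qed.

(** If the coarse mesh of [annulus 0] does not reproduce [phi], then on one of
    its elements the pullback of [phi] to the reference square is a polynomial
    outside [Q^p], which the refined meshes can only approximate at the rate
    of their mesh width to the power [p + 1]. *)
Lemma refinement_lower_bound (phi : plane R -> R) : polyfun phi ->
  (0 < Linf_dist (annulus D 0) (mesh D p 0) phi)%E ->
  exists2 c : R, 0 < c & forall l,
    ((c * (1 / 2 ^+ (l * p.+1)))%:E
     <= Linf_dist (Omega D `\` closure (cap D l)) (mesh D p l) phi)%E.
Proof.
move=> Pphi C0_gt0.
have [n nQ] : exists n : 'I_(nelt D), ~ poly_Q p (phi \o G 0 n).
  apply: contrapT => /forallNP allQ; move: C0_gt0; apply/negP; rewrite -leNgt.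
  have phiS : discrete_space (annulus D 0) (mesh D p 0) phi.
    split.
      apply: (@annulus_L2 _ D 0 phi phi 0 Pphi); first exact: polyfun_measurable.
      by move=> z _; rewrite subrr normr0.
    move=> w [i /=]; rewrite leqn0 => /eqP -> [n _ [j _ <-]].
    by exists (phi \o G 0 n) => //; exact: contrapT (allQ n).
  apply: le_trans (ereal_inf_lbound _) _; first by exists phi.
  by apply: Linf_norm_le => // z _; rewrite /= subrr normr0.
have [/poly_Q_polyfun P1 /poly_Q_polyfun P2] := G_poly 0 n.
have [c c0 cP] := dyadic_square_lower_bound (polyfun_comp_plane Pphi P1 P2) nQ.
exists c => // l; apply/ereal_infP => _ /= [fh [_ fhS] <-].
set theta := _ `\` _.
have [->|[M M0 ME]] := Linf_normP theta (phi \- fh); first exact: leey.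
have [j jP] := cP (l - 0)%N.
have wl : mesh D p l (cell p 0 n j) by exists 0%N => //=; exists n => //; exists j.
have [P QP fhP] := fhS _ wl.
have le_M : (Linf_norm theta (phi \- fh)%R <= M%:E)%E by rewrite ME.
rewrite ME lee_fin -[l in 2 ^+ (l * _)]subn0; apply: (jP P M QP).
apply: element_error_le Pphi QP fhP _ le_M.
move=> _ [y jy <-]; apply: (annulus_outside_cap (leq0n l)); apply: elt_sub.
by exists y => //; exact: subsquare_sub_unit_square jy.
Qed.

End lower_bounds.

Theorem theorem15 (R : realType) (D : ring_domain R) (p : nat)
    (capS : nat -> set (plane R -> R)) (k0 r : nat) (phi : plane R -> R)
    (capS_fin : forall l, fin_dim_on (cap D l) (capS l))
    (capS_Hr : forall l, capS l `<=` sobolev_space r (cap D l))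
    (k0_min : is_kappa0 D p k0)
    (cap_repro : exists2 k, repro_degree (cap_element D capS 0) k & (k0 <= k)%N)
    (r_le : (r <= k0 + 1)%N)
    (phi_hom : poly_Pmax (k0 + 1) phi)
    (phi_norm : sobolev_norm (p + 1) (Omega D) phi = 1%E)
    (phi_sup : error_ratio D p capS r phi =
       ereal_sup [set error_ratio D p capS r psi
         | psi in [set psi | poly_Pmax (k0 + 1) psi /\ psi <> cst 0]])
    (C0_gt0 : (0 < Linf_dist (annulus D 0) (mesh D p 0) phi)%E) :
  let C0 := Linf_dist (annulus D 0) (mesh D p 0) phi in
  exists2 c0 : R, 0 < c0 &
    forall l : nat,
      (Order.max (C0 * (lambda D ^+ (l * (k0 + 1)))%:E)
                 (c0 * (1 / 2 ^+ (l * (p + 1))))%:E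
       <= Linf_dist (Omega D `\` closure (cap D l)) (mesh D p l) phi)%E.
Proof.
have [c c_gt0 c_le] := refinement_lower_bound (poly_Pmax_polyfun phi_hom) C0_gt0.
exists c => // l; rewrite ge_max; apply/andP; split.
  exact: scaling_lower_bound.
by rewrite addn1; exact: c_le.
Qed.
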